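(* Let $k\ge1$. The probability mass function $g_n^{(II)}(x)=P(N_n^{(II)}=x)$ satisfies, for $n>k$, the recursive scheme $$g_{n}^{(II)}(x)=g_{n-1}^{(II)}(x)-p^{k}q\,g_{n-k-1}^{(II)}(x)+p^{k}q\,g_{n-k-1}^{(II)}(x-1),$$ with initial conditions $g_{n}^{(II)}(x)=\delta_{0,x}$ for $0\le n<k$, and $g_{k}^{(II)}(0)=1-p^{k}$, $g_{k}^{(II)}(1)=p^{k}$, $g_{k}^{(II)}(x)=0$ for $x>1$.
   Context: $(X_i)_{i\ge1}$ is an infinite sequence of independent Bernoulli trials with $P(X_i=1)=p$, $0<p<1$, and $P(X_i=0)=q=1-p$. $N_n^{(II)}$ is the number of success runs of length at least $k$ in the first $n$ trials, i.e. the number of maximal blocks of consecutive ones in $X_1,\dots,X_n$ (preceded and followed by a zero or by the beginning or end of the sequence $X_1,\dots,X_n$) having length $\ge k$. Conventions: $x$ is a nonnegative integer and $g_n^{(II)}(x)=0$ for $x<0$; $\delta_{0,x}$ is the Kronecker delta. *)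

(* Defs.v *)
From HB Require Import structures.
From mathcomp Require Import all_boot all_order all_algebra finmap.
From mathcomp Require Import all_classical all_reals all_analysis.
Set Implicit Arguments.
Unset Strict Implicit.
Unset Printing Implicit Defensive.
Import Order.TTheory GRing.Theory Num.Theory.
Import numFieldNormedType.Exports.
Local Open Scope classical_set_scope.
Local Open Scope ring_scope.

(* Mutual independence: the product rule over every finite subfamily. *)
Definition independent_RVs d d' (T : measurableType d) (T' : measurableType d')
    (R : realType) (P : probability T R) (I : choiceType)
    (X : I -> {RV P >-> T'}) : Prop :=
  forall (J : {fset I}) (A : I -> set T'),
    (forall i, i \in J -> measurable (A i)) ->
    P (\bigcap_(i in [set` J]) (X i @^-1` A i)) =
    (\prod_(i <- J) P (X i @^-1` A i))%E.

(* The trials are indexed from 0: [X i] is the (i + 1)-st trial, with [true]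
   standing for 1 (success) and [false] for 0 (failure). *)
Definition bernoulli_trials d (T : measurableType d) (R : realType)
    (P : probability T R) (p : R) (X : nat -> {RV P >-> bool}) : Prop :=
  [/\ independent_RVs X,
      forall i, P [set w | X i w = true] = p%:E &
      forall i, P [set w | X i w = false] = (1 - p)%:E].

(* The entries of [s] at positions a, ..., b - 1 (counted from 0) form a
   maximal nonempty block of ones; meant for b <= size s. *)
Definition success_run (s : seq bool) (a b : nat) : bool :=
  [&& (a < b)%N,
      [forall i : 'I_(size s), (a <= i < b)%N ==> nth false s i],
      (a == 0%N) || ~~ nth false s a.-1 &
      (b == size s) || ~~ nth false s b].

Definition num_runs (k : nat) (s : seq bool) : nat :=
  #|[set ab : 'I_(size s).+1 * 'I_(size s).+1 |
      success_run s ab.1 ab.2 && (k <= ab.2 - ab.1)%N]%SET|.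

Section run_count.
Context d (T : measurableType d) (R : realType) (P : probability T R).
Variables (X : nat -> {RV P >-> bool}) (k n : nat).

Definition run_count (w : T) : R :=
  (num_runs k (mkseq (fun i => X i w) n))%:R.

Lemma measurable_run_count : measurable_fun [set: T] run_count.
Proof.
move=> _ S _; rewrite setTI.
have -> : run_count @^-1` S =
    \bigcup_(t in [set t : n.-tuple bool | S (num_runs k t)%:R])
      \bigcap_(i in [set: 'I_n]) (X i @^-1` [set tnth t i]).
  apply/seteqP; split => [w Sw|w [t St Xt]] /=.
    exists (Tuple (introT eqP (size_mkseq (fun i => X i w) n))) => //.
    by move=> i _ /=; rewrite (tnth_nth false) /= nth_mkseq.
  rewrite /run_count; suff -> : mkseq (fun i => X i w) n = t by [].
  apply: (@eq_from_nth _ false) => [|i]; rewrite size_mkseq ?size_tuple// => ltin.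
  by rewrite nth_mkseq// (Xt (Ordinal ltin) I) (tnth_nth false).
apply: fin_bigcup_measurable => [|t _]; first exact: finite_finset.
apply: fin_bigcap_measurable => [|i _]; first exact: finite_finset.
by rewrite -[X in measurable X]setTI; exact: measurable_funP.
Qed.

HB.instance Definition _ :=
  isMeasurableFun.Build _ _ _ _ run_count measurable_run_count.

(* [x] ranges over all integers, so that [x - 1] needs no truncation; the
   convention that the value is 0 for [x < 0] holds by [run_pmf_lt0]. *)
Definition run_pmf (x : int) : R := pmf (run_count : {RV P >-> R}) x%:~R.

Lemma run_pmf_lt0 (x : int) : x < 0 -> run_pmf x = 0.
Proof.
move=> x0; rewrite /run_pmf /pmf (_ : _ @^-1` _ = set0) ?measure0//.
apply/seteqP; split => // w /= Nx.
have := ler0n R (num_runs k (mkseq (fun i => X i w) n)).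
by rewrite -/(run_count w) Nx ler0z leNgt x0.
Qed.

End run_count.

(* Main.v *)
(* A run of length at least [k] is counted at the trial where its length
   reaches [k], so N_n - N_{n-1} is, for n > k, the indicator of the event A
   that the last k + 1 trials read 0 1 ... 1.  On A the trial n - k is a 0 and
   is followed by only k - 1 ones before trial n, so N_{n-1} = N_{n-k-1} there;
   and A, of probability p^k q, is independent of the first n - k - 1 trials.
   Comparing N_n with N_{n-1} on A and off A gives the recursion. *)
Require Import Defs.
From HB Require Import structures.
From mathcomp Require Import all_boot all_order all_algebra finmap zify.
From mathcomp Require Import all_classical all_reals all_analysis.
Import Order.TTheory GRing.Theory Num.Theory.
Import numFieldNormedType.Exports.
Local Open Scope classical_set_scope.
Local Open Scope ring_scope.

(** * Counting runs by their starting positions *)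

Definition run_start (k : nat) (f : nat -> bool) (a : nat) : bool :=
  ((a == 0%N) || ~~ f a.-1) && all f (iota a k).

(** The default value [false] of [nth] acts as a zero placed just past the end of [s], which absorbs
    the boundary case [b = size s]. *)
Lemma success_runP (s : seq bool) (a b : nat) : (b <= size s)%N ->
  reflect [/\ (a < b)%N, forall i, (a <= i < b)%N -> nth false s i,
              (a == 0%N) || ~~ nth false s a.-1 & ~~ nth false s b]
          (success_run s a b).
Proof.
move=> bs; rewrite /success_run.
have -> : (b == size s) || ~~ nth false s b = ~~ nth false s b.
  by case: eqVneq => //= ->; rewrite nth_default.
apply: (iffP and4P) => -[ab r l e]; split => //.
  move=> i iab; have ilt : (i < size s)%N by case/andP: iab => _ /leq_trans; exact.
  by move/forallP: r => /(_ (Ordinal ilt)) /implyP /(_ iab).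
by apply/forallP => i; apply/implyP/r.
Qed.

(** A run is determined by its start, so the projection [fst] is injective on runs. Only the first
    [k] entries after a start need testing, because the right end can then be recovered as the first
    zero that follows them. *)
Lemma num_runsE (k : nat) (s : seq bool) : (0 < k)%N ->
  num_runs k s =
  #|[set a : 'I_(size s).+1 |
      (a + k <= size s)%N && run_start k (nth false s) a]%SET|.
Proof.
move=> k0; rewrite /num_runs -(@card_in_imset _ _ fst).
  apply: eq_card => a; rewrite !inE; apply/imsetP/andP => [[[a' b]]|[aks]].
    rewrite inE /= => /andP[/success_runP-/(_ (ltn_ord b))[ab r l e] kab] -> /=.
    have bs := ltn_ord b; split; first lia.
    rewrite /run_start l; apply/allP => i; rewrite mem_iota => ia.
    by apply: r; lia.
  case/andP => l /allP r.
  (* The end of the run is the least zero at or after [a + k]; [size s] qualifies as a candidate by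
     the default value of [nth]. *)
  have exb : exists b, (a + k <= b)%N && ~~ nth false s b.
    by exists (size s); rewrite aks nth_default.
  case: (ex_minnP exb) => b /andP[akb e] bmin.
  have bs : (b <= size s)%N by apply: bmin; rewrite aks nth_default.
  exists (a, Ordinal (bs : (b < (size s).+1)%N)) => //; rewrite inE /=.
  apply/andP; split; last lia.
  apply/success_runP => //; split => //; first lia.
  move=> i /andP[ai ib]; have [iak|aki] := ltnP i (a + k).
    by apply: r; rewrite mem_iota ai.
  apply/negPn/negP => ni; have := bmin i; rewrite aki ni => /(_ isT); lia.
move=> [a b] [a' b'] /[!inE] /=.
move=> /andP[/success_runP-/(_ (ltn_ord b))[ab r _ e] _].
move=> /andP[/success_runP-/(_ (ltn_ord b'))[ab' r' _ e'] _] aa'.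
rewrite -{}aa' in ab' r' *; congr (_, _); apply: val_inj => /=.
(* If the two ends differed, the smaller one would be a zero lying inside the longer run. *)
case: (ltngtP b b') => // [bb'|b'b].
  by move: e; rewrite r'// bb' ltnW.
by move: e'; rewrite r// b'b ltnW.
Qed.

(** In this form the summand does not depend on [n]; only the range of admissible starts does, so
    prefixes of different lengths can be compared by cutting the sum. *)
Lemma num_runs_mkseq (k : nat) (f : nat -> bool) (n : nat) : (0 < k)%N ->
  num_runs k (mkseq f n) = (\sum_(0 <= a < n.+1 - k) run_start k f a)%N.
Proof.
move=> k0; rewrite num_runsE// -sum1_card.
rewrite (eq_bigl (fun a : 'I__ => (a + k <= n)%N && run_start k f a)); last first.
  move=> a; rewrite inE; move: (nat_of_ord a) => {}a.
  rewrite size_mkseq; case: leqP => //= akn.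
  rewrite /run_start; congr andb.
    by case: eqVneq => //= a0; rewrite nth_mkseq//; lia.
  by apply: eq_in_all => i; rewrite mem_iota => ia; rewrite nth_mkseq//; lia.
rewrite size_mkseq big_mkcond /=.
rewrite -(big_mkord xpredT
  (fun a => if (a + k <= n)%N && run_start k f a then 1 else 0)%N).
rewrite (@big_cat_nat _ _ _ (n.+1 - k)) ?leq_subr//=.
rewrite [X in (_ + X)%N]big_nat [X in (_ + X)%N]big1 ?addn0; last first.
  move=> i ii; case: ifP => //. lia.
by apply: eq_big_nat => i ink; rewrite (_ : (i + k <= n)%N); [case: run_start | lia].
Qed.

Lemma num_runs_small (k : nat) (f : nat -> bool) (n : nat) : (n < k)%N ->
  num_runs k (mkseq f n) = 0%N.
Proof.
move=> nk; rewrite num_runs_mkseq; last lia.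
by rewrite big_geq//; lia.
Qed.

Lemma num_runs_last (k : nat) (f : nat -> bool) (n : nat) :
  (0 < k)%N -> (k <= n)%N ->
  num_runs k (mkseq f n) =
  (num_runs k (mkseq f (n - 1)) + run_start k f (n - k))%N.
Proof.
move=> k0 kn; rewrite !num_runs_mkseq//.
have -> : ((n - 1).+1 - k = n - k)%N by lia.
by rewrite subSn// big_nat_recr.
Qed.

Lemma num_runs_before_start (k : nat) (f : nat -> bool) (n : nat) :
  (0 < k)%N -> (k < n)%N -> run_start k f (n - k) ->
  num_runs k (mkseq f (n - 1)) = num_runs k (mkseq f (n - k - 1)).
Proof.
move=> k0 kn /andP[z _]; rewrite !num_runs_mkseq//.
have -> : ((n - 1).+1 - k = n - k)%N by lia.
have -> : ((n - k - 1).+1 - k = n - k - k)%N by lia.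
rewrite (@big_cat_nat _ _ _ (n - k - k)) ?leq_subr//=.
rewrite [X in (_ + X)%N]big_nat [X in (_ + X)%N]big1 ?addn0// => i ii.
(* For [n - k - k <= i < n - k], the block of length [k] starting at [i] covers position
   [(n - k).-1], which holds a zero. *)
rewrite /run_start; case: allP => [/(_ (n - k).-1)|_]; last by rewrite andbF.
rewrite mem_iota => fi; move: z; rewrite fi; lia.
Qed.

(** * Independence of a prefix and the segment that follows it *)

Section trials.
Context d (T : measurableType d) (R : realType) (P : probability T R).
Context (p : R) (X : nat -> {RV P >-> bool}) (X_trials : bernoulli_trials p X).

Definition trial_weight (b : bool) : R := if b then p else 1 - p.

Definition segment (m : nat) (s : seq bool) : set T :=
  [set w | [seq X i w | i <- iota m (size s)] = s].

(** Taking an arbitrary predicate on lists keeps this class of events stable when the last trial is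
    fixed, which the inductions on [n] rely on. *)
Definition prefix_event (n : nat) (E : pred (seq bool)) : set T :=
  [set w | E (mkseq (X^~ w) n)].

Lemma trial_prob (i : nat) (b : bool) :
  P (X i @^-1` [set b]) = (trial_weight b)%:E.
Proof. by case: X_trials => _ Pt Pf; case: b; [exact: Pt | exact: Pf]. Qed.

Lemma measurable_trial (i : nat) (B : set bool) : measurable (X i @^-1` B).
Proof. by rewrite -[X in measurable X]setTI; exact: measurable_funP. Qed.

Lemma segment_nil (m : nat) : segment m [::] = setT.
Proof. by apply/seteqP; split. Qed.

Lemma segment_cons (m : nat) (b : bool) (s : seq bool) :
  segment m (b :: s) = X m @^-1` [set b] `&` segment m.+1 s.
Proof.
by apply/seteqP; split => w; rewrite /segment /= => -[-> ->].
Qed.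

Lemma measurable_segment (m : nat) (s : seq bool) : measurable (segment m s).
Proof.
elim: s m => [|b s IH] m; first by rewrite segment_nil.
by rewrite segment_cons; apply: measurableI => //; exact: measurable_trial.
Qed.

(** This is the shape of event to which [independent_RVs] applies. *)
Lemma segmentE (m : nat) (s : seq bool) : segment m s =
  \bigcap_(i in [set` [fset i | i in iota m (size s)]%fset])
    (X i @^-1` [set nth false s (i - m)]).
Proof.
elim: s m => [|b s IH] m.
  by rewrite segment_nil; apply/seteqP; split => // w _ i /=; rewrite !inE.
rewrite segment_cons IH; apply/seteqP; split => w.
  move=> [/= Xm Xs] i /=; rewrite !inE => /orP[/eqP->|im]; first by rewrite subnn.
  have mi : (m < i)%N by move: im; rewrite mem_iota => /andP[].
  by rewrite -(subnSK mi) /=; apply: (Xs i); rewrite /= !inE.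
move=> Xs; split => /=.
  by have := Xs m; rewrite /= subnn; apply; rewrite !inE eqxx.
move=> i /=; rewrite !inE => im.
have mi : (m < i)%N by move: im; rewrite mem_iota => /andP[].
by have := Xs i; rewrite /= -(subnSK mi) /=; apply; rewrite !inE im orbT.
Qed.

Lemma segment_prob (m : nat) (s : seq bool) :
  P (segment m s) = (\prod_(b <- s) trial_weight b)%:E.
Proof.
case: X_trials => indep _ _; rewrite segmentE indep//.
rewrite (eq_bigr (fun i => (trial_weight (nth false s (i - m)))%:E)); last first.
  by move=> i _; exact: trial_prob.
rewrite prodEFin; congr (_%:E).
rewrite (perm_big (iota m (size s))) /=; last first.
  apply: uniq_perm; rewrite ?fset_uniq ?iota_uniq// => i.
  by rewrite !inE.
rewrite -[X in iota X]addn0 iotaDl big_map [RHS](big_nth false) /index_iota subn0.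
by apply: eq_bigr => i _; rewrite addKn.
Qed.

Lemma prefix_event0 (E : pred (seq bool)) :
  prefix_event 0 E = if E [::] then setT else set0.
Proof.
by rewrite /prefix_event; case: ifP => E0; apply/seteqP; split => w //=;
  rewrite /mkseq /= E0.
Qed.

Lemma prefix_eventS (n : nat) (E : pred (seq bool)) (b : bool) :
  prefix_event n.+1 E `&` X n @^-1` [set b] =
  prefix_event n (fun t => E (rcons t b)) `&` X n @^-1` [set b].
Proof.
by apply/seteqP; split => w [] /=;
  rewrite /prefix_event /= mkseqS => H Xb; rewrite Xb in H *.
Qed.

Lemma setI_trialU (n : nat) (A : set T) :
  A = (A `&` X n @^-1` [set true]) `|` (A `&` X n @^-1` [set false]).
Proof.
rewrite -setIUr -preimage_setU [X in _ @^-1` X](_ : _ = setT) ?preimage_setT ?setIT//.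
by apply/seteqP; split => // -[]; [left | right].
Qed.

Lemma measurable_prefix_event (n : nat) (E : pred (seq bool)) :
  measurable (prefix_event n E).
Proof.
elim: n E => [|n IH] E.
  by rewrite prefix_event0; case: ifP.
rewrite (setI_trialU n (prefix_event _ _)) !prefix_eventS.
by apply: measurableU; apply: measurableI => //; exact: measurable_trial.
Qed.

Lemma prob_split (n : nat) (A : set T) : measurable A ->
  P A = (P (A `&` X n @^-1` [set true]) + P (A `&` X n @^-1` [set false]))%E.
Proof.
move=> mA; have mX b := measurable_trial n [set b].
rewrite {1}(setI_trialU n A) measureU//; [exact: measurableI..|].
by apply/seteqP; split => // w [] [] _ /= -> [].
Qed.

Lemma prefix_segment_indep (n : nat) (E : pred (seq bool)) (s : seq bool) :
  P (prefix_event n E `&` segment n s) =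
  (P (prefix_event n E) * P (segment n s))%E.
Proof.
elim: n E s => [|n IH] E s.
  rewrite prefix_event0; case: ifP => _.
    by rewrite setTI probability_setT mul1e.
  by rewrite set0I measure0 mul0e.
have mE := measurable_prefix_event.
have mS := measurable_segment.
have step b : P (prefix_event n.+1 E `&` segment n.+1 s `&` X n @^-1` [set b]) =
    (P (prefix_event n.+1 E `&` X n @^-1` [set b]) * P (segment n.+1 s))%E.
  rewrite setIAC prefix_eventS -setIA -segment_cons IH.
  (* A second use of the induction hypothesis, with the one-letter segment [[:: b]], evaluates the
     prefix factor on the right-hand side. *)
  have := IH (fun t => E (rcons t b)) [:: b].
  rewrite (segment_cons n b [::]) segment_nil setIT => ->.
  by rewrite trial_prob !segment_prob big_cons EFinM muleA.
rewrite (prob_split n _ (measurableI _ _ (mE _ _) (mS _ _))) !step.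
rewrite [in RHS](prob_split n _ (mE _ _)) ge0_muleDl//.
Qed.

Lemma segment_nseq (m k : nat) :
  segment m (nseq k true) = [set w | all (X^~ w) (iota m k)].
Proof.
elim: k m => [|k IH] m; first by rewrite segment_nil; apply/seteqP; split.
by rewrite /= segment_cons IH; apply/seteqP; split => w /= => [[-> ->]|/andP[-> ->]].
Qed.

(** Links the form whose probability is computable to the form used in counting. Since [k < n], the
    start [n - k] is not 0, so a genuine trial precedes it and must be a failure. *)
Lemma segment_run_start (k n : nat) : (k < n)%N ->
  segment (n - k - 1) (false :: nseq k true) =
  [set w | run_start k (X^~ w) (n - k)].
Proof.
move=> kn; rewrite segment_cons segment_nseq subn1 prednK ?subn_gt0//.
apply/seteqP; split => w /=.
  by move=> [z r]; rewrite /run_start z orbT.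
move=> /andP[]; rewrite subn_eq0 leqNgt kn /= => /negbTE z r.
by split.
Qed.

(** * The probability mass function and its recursion *)

Lemma run_pmfE (k n : nat) (x : int) :
  run_pmf X k n x =
  fine (P (prefix_event n (fun t => (num_runs k t)%:Z == x))).
Proof.
rewrite /run_pmf /pmf; congr (fine (P _)); apply/seteqP; split => w /=.
  by rewrite /run_count /prefix_event /= pmulrn => /intr_inj ->.
by rewrite /prefix_event /= => /eqP <-; rewrite /run_count pmulrn.
Qed.

Lemma prefix_num_runs_small (k n : nat) (x : int) : (n < k)%N ->
  prefix_event n (fun t => (num_runs k t)%:Z == x) =
  if 0 == x then setT else set0.
Proof.
move=> nk; rewrite /prefix_event; case: ifP => x0; apply/seteqP; split => w //=;
  by rewrite num_runs_small// x0.
Qed.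

(** Among [k] trials the only possible start is 0, so the count is 1 when all trials succeed and 0
    otherwise. *)
Lemma prefix_num_runs_diag (k : nat) (x : int) : (0 < k)%N ->
  prefix_event k (fun t => (num_runs k t)%:Z == x) =
  [set w | (segment 0 (nseq k true) w /\ x = 1) \/
           (~ segment 0 (nseq k true) w /\ x = 0)].
Proof.
move=> k0; rewrite segment_nseq /prefix_event; apply/seteqP; split => w /=;
  rewrite num_runs_last// num_runs_small ?subn1 ?prednK// add0n subnn /run_start /=;
  case: all.
- by move/eqP=> <-; left.
- by move/eqP=> <-; right.
- by case=> [[_ ->]|[]].
- by case=> [[]|[_ ->]].
Qed.

Lemma run_pmf_rec (k n : nat) (x : int) : (0 < k)%N -> (k < n)%N ->
  run_pmf X k n x = run_pmf X k (n - 1) x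
    - p ^+ k * (1 - p) * run_pmf X k (n - k - 1) x
    + p ^+ k * (1 - p) * run_pmf X k (n - k - 1) (x - 1).
Proof.
move=> k0 kn; pose G m (y : int) := prefix_event m (fun t => (num_runs k t)%:Z == y).
have gE m y : run_pmf X k m y = fine (P (G m y)) by exact: run_pmfE.
set A := segment (n - k - 1) (false :: nseq k true).
have mG m y : measurable (G m y) by exact: measurable_prefix_event.
have mA : measurable A by exact: measurable_segment.
have split_A B : measurable B ->
    fine (P B) = fine (P (B `\` A)) + fine (P (B `&` A)).
  move=> mB; rewrite (measureDI P mB mA) fineD// fin_num_measure//.
    exact: measurableD.
  exact: measurableI.
have PA : fine (P A) = p ^+ k * (1 - p).
  by rewrite segment_prob big_cons big_nseq /= iter_mulr_1 mulrC.
(* [A] begins at trial index [n - k - 1], exactly where the prefix stops. *)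
have indep y : fine (P (G (n - k - 1)%N y `&` A)) =
    p ^+ k * (1 - p) * fine (P (G (n - k - 1)%N y)).
  rewrite prefix_segment_indep fineM ?fin_num_measure//.
    by rewrite -/A -/(G _ _) PA mulrC.
  exact: mG.
have AE w : A w <-> run_start k (X^~ w) (n - k) by rewrite /A segment_run_start.
(* Off [A] no run reaches length [k] at the last trial, so the count is unchanged. *)
have GD : G n x `\` A = G (n - 1)%N x `\` A.
  apply/seteqP; split => w [+ Aw]; rewrite /G /prefix_event /=;
    have /negP/negbTE r : ~ run_start k (X^~ w) (n - k) by move=> /AE.
    by rewrite num_runs_last// ?r ?addn0 ?(ltnW kn).
  by split => //=; rewrite num_runs_last// ?r ?addn0 ?(ltnW kn).
(* On [A] the last trial adds exactly one run to those of the first [n - k - 1] trials. *)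
have GI : G n x `&` A = G (n - k - 1)%N (x - 1) `&` A.
  have eqx w : A w -> ((num_runs k (mkseq (X^~ w) n))%:Z == x) =
      ((num_runs k (mkseq (X^~ w) (n - k - 1)))%:Z == x - 1).
    move=> /AE r; rewrite num_runs_last ?(ltnW kn)// r num_runs_before_start//.
    by rewrite PoszD (can2_eq (addrK 1) (subrK 1)).
  by apply/seteqP; split => w [Gw Aw]; split => //; move: Gw;
    rewrite /G /prefix_event /= eqx.
have GI' : G (n - 1)%N x `&` A = G (n - k - 1)%N x `&` A.
  have eqx w : A w -> num_runs k (mkseq (X^~ w) (n - 1)) =
      num_runs k (mkseq (X^~ w) (n - k - 1)).
    by move=> /AE r; rewrite num_runs_before_start.
  by apply/seteqP; split => w [Gw Aw]; split => //; move: Gw;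
    rewrite /G /prefix_event /= eqx.
rewrite !gE (split_A (G n x))// (split_A (G (n - 1)%N x))// GD GI GI' !indep.
(* The contribution of [A] to the term for [n - 1] cancels against the subtracted term. *)
by rewrite addrK.
Qed.

End trials.

Arguments segment {d T R P} X m s.
Arguments measurable_segment {d T R P} X m s.

Theorem theorem4p4 (d : measure_display) (T : measurableType d) (R : realType)
    (P : probability T R) (p q : R) (X : nat -> {RV P >-> bool}) (k : nat)
    (p_gt0 : 0 < p) (p_lt1 : p < 1) (q_def : q = 1 - p)
    (X_trials : bernoulli_trials p X) (k_ge1 : (1 <= k)%N) :
  let g (n : nat) (x : int) : R := run_pmf X k n x in
  [/\ forall (n x : nat), (k < n)%N ->
        g n x%:Z = g (n - 1)%N x%:Z - p ^+ k * q * g (n - k - 1)%N x%:Z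
                   + p ^+ k * q * g (n - k - 1)%N (x%:Z - 1),
      forall (n x : nat), (n < k)%N -> g n x%:Z = (0%N == x)%:R,
      g k 0 = 1 - p ^+ k,
      g k 1 = p ^+ k &
      forall x : nat, (1 < x)%N -> g k x%:Z = 0].
Proof.
move=> g; rewrite q_def.
have PS : P (segment X 0 (nseq k true)) = (p ^+ k)%:E.
  by rewrite (segment_prob _ _ _ _ _ _ X_trials) big_nseq /= iter_mulr_1.
have mS := measurable_segment X 0 (nseq k true).
split.
- by move=> n x kn; exact: run_pmf_rec.
- move=> n x nk; rewrite /g run_pmfE prefix_num_runs_small// eqz_nat.
  by case: eqVneq => _; rewrite ?probability_setT ?measure0.
- rewrite /g run_pmfE prefix_num_runs_diag//.
  (* With [x = 0] only the second alternative of [prefix_num_runs_diag] survives; with [x = 1] only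
     the first, and with [x > 1] neither. *)
  rewrite (_ : mkset _ = ~` segment X 0 (nseq k true)).
    by rewrite probability_setC// PS.
  by apply/seteqP; split => w /= => [[[]|[]]|] //; right.
- rewrite /g run_pmfE prefix_num_runs_diag//.
  rewrite (_ : mkset _ = segment X 0 (nseq k true)) ?PS//.
  by apply/seteqP; split => w /= => [[[]|[]]|] //; left.
- move=> x x1; rewrite /g run_pmfE prefix_num_runs_diag//.
  rewrite (_ : mkset _ = set0) ?measure0//.
  by apply/seteqP; split => w //= [[_ [x1']]|[_ [x0]]]; lia.
Qed.
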